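(* Let $n\ge 2$ be an integer and let $\varphi\in\operatorname{End}(\operatorname{BS}(1,n))$ be an endomorphism different from the identity. Then $\operatorname{Fix}\varphi\cong\mathbb{Z}$, or $\operatorname{Fix}\varphi\cong\mathbb{Z}\left[\tfrac{1}{n}\right]$ (as groups), or $\operatorname{Fix}\varphi$ is trivial. When $\operatorname{Fix}\varphi\cong\mathbb{Z}$, a generator of $\operatorname{Fix}\varphi$ is computable.
   Context: $\operatorname{BS}(1,n)=\langle a,t\mid tat^{-1}=a^n\rangle$. $\operatorname{End}(G)$ is the monoid of endomorphisms of a group $G$. For $\varphi\in\operatorname{End}(G)$, $\operatorname{Fix}\varphi=\{g\in G\mid \varphi(g)=g\}$, a subgroup of $G$. $\mathbb{Z}\left[\tfrac1n\right]$ denotes the additive group $\{l/n^k\mid l\in\mathbb{Z},k\ge 0\}\subset\mathbb{Q}$. ''Computable'' means that there is an algorithm which, given $n$ and $\varphi$ (specified by the images of the two generators), outputs a generator. *)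

(* Defs.v *)
From HB Require Import structures.
From mathcomp Require Import all_boot all_order all_algebra.
From mathcomp Require Import boolp.

Set Warnings "-redundant-canonical-projection,-projection-no-head-constant".

Set Implicit Arguments.
Unset Strict Implicit.
Unset Printing Implicit Defensive.

Import GRing.Theory Num.Theory.
Local Open Scope quotient_scope.
Local Open Scope group_scope.

(* Words over {a, a^-1, t, t^-1}. The first component of a letter selects the
   generator (false for a, true for t); the second one tells whether it is
   inverted. *)
Definition letter : Type := (bool * bool)%type.
Definition word : Type := seq letter.

Definition letter_a : letter := (false, false).
Definition letter_t : letter := (true, false).
Definition inv_letter (x : letter) : letter := (x.1, ~~ x.2).
Definition inv_word (w : word) : word := rev (map inv_letter w).

(* The congruence on words presented by t a t^-1 = a^n, so that words modulo
   bs_eq n form the group < a, t | t a t^-1 = a^n >. *)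
Inductive bs_eq (n : nat) : word -> word -> Prop :=
| bs_refl w : bs_eq n w w
| bs_sym v w : bs_eq n v w -> bs_eq n w v
| bs_trans u v w : bs_eq n u v -> bs_eq n v w -> bs_eq n u w
| bs_cat u u' v v' :
    bs_eq n u u' -> bs_eq n v v' -> bs_eq n (u ++ v) (u' ++ v')
| bs_cancel x : bs_eq n [:: x; inv_letter x] [::]
| bs_relator :
    bs_eq n [:: letter_t; letter_a; inv_letter letter_t] (nseq n letter_a).

Definition bs_rel (n : nat) : rel word := fun v w => `[< bs_eq n v w >].

Lemma bs_rel_refl n : reflexive (bs_rel n).
Proof. by move=> w; apply/asboolP/bs_refl. Qed.

Lemma bs_rel_sym n : symmetric (bs_rel n).
Proof. by move=> v w; apply/asboolP/asboolP; exact: bs_sym. Qed.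

Lemma bs_rel_trans n : transitive (bs_rel n).
Proof.
by move=> v u w /asboolP uv /asboolP vw; apply/asboolP; exact: bs_trans uv vw.
Qed.

Canonical bs_equiv n :=
  EquivRel (bs_rel n) (bs_rel_refl n) (bs_rel_sym n) (@bs_rel_trans n).

Definition BS (n : nat) : Type := {eq_quot (bs_equiv n)}.

HB.instance Definition _ n := Choice.on (BS n).
HB.instance Definition _ n := EqQuotient.on (BS n).

Definition of_word (n : nat) (w : word) : BS n := \pi_(BS n) w.

Lemma of_wordP n v w : of_word n v = of_word n w <-> bs_eq n v w.
Proof.
split=> [vw | vw]; first exact/asboolP/(eqquotP (BS n)).
by apply/(eqquotP (BS n))/asboolP.
Qed.

Lemma inv_letterK : involutive inv_letter.
Proof. by case=> g b; rewrite /inv_letter /= negbK. Qed.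

Lemma inv_wordK : involutive inv_word.
Proof.
by move=> w; rewrite /inv_word map_rev revK -map_comp map_id_in // => x _ /=;
  rewrite inv_letterK.
Qed.

Lemma bs_mulwV n w : bs_eq n (w ++ inv_word w) [::].
Proof.
elim: w => [|x w IHw]; first exact: bs_refl.
have -> : (x :: w) ++ inv_word (x :: w) =
    [:: x] ++ ((w ++ inv_word w) ++ [:: inv_letter x]).
  by rewrite /inv_word /= rev_cons -cats1 catA.
apply: bs_trans (bs_cancel n x).
exact: bs_cat (bs_refl n [:: x]) (bs_cat IHw (bs_refl n _)).
Qed.

Lemma bs_mulVw n w : bs_eq n (inv_word w ++ w) [::].
Proof. by have := bs_mulwV n (inv_word w); rewrite inv_wordK. Qed.

Lemma bs_inv n v w : bs_eq n v w -> bs_eq n (inv_word v) (inv_word w).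
Proof.
move=> vw; have h1 : bs_eq n (inv_word v ++ (w ++ inv_word w)) (inv_word v).
  by have := bs_cat (bs_refl n (inv_word v)) (bs_mulwV n w); rewrite cats0.
apply: bs_trans (bs_sym h1) _; rewrite catA -[X in bs_eq _ _ X]cat0s.
apply: bs_cat (bs_refl _ _).
apply: bs_trans (bs_cat (bs_refl n _) (bs_sym vw)) _; exact: bs_mulVw.
Qed.

Definition bs_one n : BS n := of_word n [::].
Definition bs_mul n (x y : BS n) : BS n := of_word n (repr x ++ repr y).
Definition bs_invg n (x : BS n) : BS n := of_word n (inv_word (repr x)).

Lemma of_word_repr n (x : BS n) : of_word n (repr x) = x.
Proof. exact: reprK. Qed.

Lemma bs_repr n w : bs_eq n (repr (of_word n w)) w.
Proof. by apply/of_wordP; rewrite of_word_repr. Qed.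

Lemma bs_mulE n v w : bs_mul (of_word n v) (of_word n w) = of_word n (v ++ w).
Proof. by apply/of_wordP; apply: bs_cat; exact: bs_repr. Qed.

Lemma bs_invE n w : bs_invg (of_word n w) = of_word n (inv_word w).
Proof. by apply/of_wordP; apply: bs_inv; exact: bs_repr. Qed.

Lemma bs_mulA n : associative (@bs_mul n).
Proof.
move=> x y z; rewrite -(of_word_repr x) -(of_word_repr y) -(of_word_repr z).
by rewrite !bs_mulE catA.
Qed.

Lemma bs_mul1 n : left_id (bs_one n) (@bs_mul n).
Proof. by move=> x; rewrite -(of_word_repr x) bs_mulE. Qed.

Lemma bs_mulr1 n : right_id (bs_one n) (@bs_mul n).
Proof. by move=> x; rewrite -(of_word_repr x) bs_mulE cats0. Qed.

Lemma bs_mulV n : left_inverse (bs_one n) (@bs_invg n) (@bs_mul n).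
Proof.
by move=> x; rewrite -(of_word_repr x) bs_invE bs_mulE; apply/of_wordP/bs_mulVw.
Qed.

Lemma bs_mulrV n : right_inverse (bs_one n) (@bs_invg n) (@bs_mul n).
Proof.
by move=> x; rewrite -(of_word_repr x) bs_invE bs_mulE; apply/of_wordP/bs_mulwV.
Qed.

HB.instance Definition _ n :=
  isGroup.Build (BS n) (@bs_mulA n) (@bs_mul1 n) (@bs_mulr1 n)
    (@bs_mulV n) (@bs_mulrV n).

Definition bs_a n : BS n := of_word n [:: letter_a].
Definition bs_t n : BS n := of_word n [:: letter_t].

Lemma bs_relation n : bs_t n * bs_a n * (bs_t n)^-1 = bs_a n ^+ n.
Proof.
have aX m : bs_a n ^+ m = of_word n (nseq m letter_a).
  by elim: m => [|m IHm] //; rewrite expgS IHm; exact: bs_mulE.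
have -> : bs_t n * bs_a n * (bs_t n)^-1 =
    of_word n [:: letter_t; letter_a; inv_letter letter_t].
  by rewrite [_^-1]bs_invE [bs_t n * _]bs_mulE [_ * _]bs_mulE.
by rewrite aX; apply/of_wordP; exact: bs_relator.
Qed.

(* Morphisms of magmas between groups are group morphisms, so endomorphisms of
   G are the elements of {multiplicative G -> G}. *)
Definition fixg (G : groupType) (phi : {multiplicative G -> G}) : {pred G} :=
  [pred g | phi g == g].

Lemma fixg_closed (G : groupType) (phi : {multiplicative G -> G}) :
  group_closed (fixg phi).
Proof.
have phi1 : phi 1 = 1.
  by apply: (mulgI (phi 1)); rewrite -gmulfM !mulg1.
have phiV x : phi x^-1 = (phi x)^-1.
  by apply: (mulgI (phi x)); rewrite -gmulfM !mulgV.
split=> [|x y]; rewrite !inE ?phi1 // => /eqP px /eqP py.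
by rewrite gmulfM phiV px py.
Qed.

Section FixGroup.
Variables (G : groupType) (phi : {multiplicative G -> G}).

Record fix_group := FixGroup { fix_val : G; _ : fix_val \in fixg phi }.

HB.instance Definition _ := [isSub for fix_val].
HB.instance Definition _ := [Choice of fix_group by <:].
HB.instance Definition _ :=
  SubChoice_isSubGroup.Build G (fixg phi) fix_group (fixg_closed phi).

End FixGroup.

Definition isomorphic_groups (G H : groupType) : Prop :=
  exists f : {multiplicative G -> H}, bijective f.

Definition zexpg (G : groupType) (x : G) (k : int) : G :=
  match k with Posz m => x ^+ m | Negz m => x ^- m.+1 end.

Definition generates (G : groupType) (x : G) (S : {pred G}) : Prop :=
  forall g : G, g \in S <-> exists k : int, g = zexpg x k.

Definition Zinv (n : nat) : {pred rat} :=
  fun x => `[< exists (l : int) (k : nat), x = (l%:~R / n%:R ^+ k)%R >].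

Lemma Zinv_closed n : zmod_closed (Zinv n).
Proof.
split=> [|x y]; first by apply/asboolP; exists 0%R, 0; rewrite mul0r.
move=> /asboolP[l [k ->]] /asboolP[m [j ->]]; apply/asboolP.
case: n => [|n].
  have int0 (p : int) i : exists q : int, (p%:~R / 0%:R ^+ i = q%:~R :> rat)%R.
    case: i => [|i]; first by exists p; rewrite expr0 divr1.
    by exists 0%R; rewrite expr0n /= invr0 mulr0.
  have [p ->] := int0 l k; have [q ->] := int0 m j.
  by exists (p - q)%R, 0; rewrite expr0 divr1 intrB.
exists (l * n.+1%:Z ^+ j - m * n.+1%:Z ^+ k)%R, (k + j).
have nz i : (n.+1%:R ^+ i : rat)%R != 0%R by rewrite expf_neq0 ?pnatr_eq0.
by rewrite -mulNr addf_div // -exprD intrB !intrM !rmorphXn /= mulNr.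
Qed.

Record Zinv_type (n : nat) :=
  ZinvType { Zinv_val : rat; _ : Zinv_val \in Zinv n }.

HB.instance Definition _ n := [isSub for @Zinv_val n].
HB.instance Definition _ n := [Choice of Zinv_type n by <:].
HB.instance Definition _ n :=
  GRing.SubChoice_isSubZmodule.Build rat (Zinv n) (Zinv_type n) (Zinv_closed n).

(* Kleene's mu-recursive functions, as programs of given arity. *)
Inductive murec : nat -> Type :=
| Zero k : murec k
| Succ : murec 1
| Proj k (i : 'I_k) : murec k
| Comp k m (f : murec m) (g : 'I_m -> murec k) : murec k
| Prec k (f : murec k) (g : murec k.+2) : murec k.+1
| Mu k (f : murec k.+1) : murec k.

(* computes p v y: the program p, run on the arguments v, halts with output y.
   In Prec the recursion argument comes first and s lists the successive
   values; in Mu every value tested before y must be defined and nonzero. *)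
Fixpoint computes (k : nat) (p : murec k) : k.-tuple nat -> nat -> Prop :=
  match p in murec k return k.-tuple nat -> nat -> Prop with
  | Zero _ => fun _ y => y = 0
  | Succ => fun v y => y = (thead v).+1
  | Proj _ i => fun v y => y = tnth v i
  | Comp k m f g => fun v y =>
      exists w : m.-tuple nat,
        (forall i, computes (g i) v (tnth w i)) /\ computes f w y
  | Prec k f g => fun v y =>
      exists s : nat -> nat,
        [/\ computes f (behead_tuple v) (s 0),
            forall i, (i < thead v)%N ->
              computes g (cons_tuple i (cons_tuple (s i) (behead_tuple v)))
                (s i.+1)
          & y = s (thead v)]
  | Mu k f => fun v y =>
      computes f (cons_tuple y v) 0 /\
      forall i, (i < y)%N -> exists z : nat, computes f (cons_tuple i v) z.+1
  end.

(* Bijective base-4 numeration, least significant digit first, with digits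
   1, 2, 3, 4 for a, t, a^-1, t^-1. *)
Definition digit (x : letter) : nat := (x.1 + 2 * x.2).+1.
Definition code (w : word) : nat := foldr (fun x c => digit x + 4 * c)%N 0 w.

(* Main.v *)
(** BS(1,n) is Z[1/n] >< Z, with a = (1, 0), t = (0, 1) and t acting as
    multiplication by n.  An endomorphism sends a to some (x, 0) and t to some
    (y, l), and the relation forces x = 0 or l = 1.  If x = 0, a fixed element
    of height k is the k-th power of the image of t, so the fixed subgroup is
    trivial unless l = 1, when the image of t generates it.  If l = 1, then
    (z, k) is fixed iff (1 - x) (n - 1) z = y (n^k - 1).  For x = 1 and y <> 0
    this says k = 0, which leaves Z[1/n]; for x <> 1 it determines z from k, so
    the fixed subgroup embeds in Z, and a generator has the least k > 0 for
    which z is in Z[1/n].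
    With x = X / n^m, y = Y / n^m and q = (n - 1) |n^m - X|, the powers of n
    modulo q are periodic from the exponent q on, with a period at most q.
    Hence z is in Z[1/n] iff q divides n^q |Y| (n^k - 1), and the least such k
    is at most q, so that the generator is obtained from bounded sums of
    arithmetic functions of n and of the digits of the codes. *)

Require Import Defs.
From HB Require Import structures.
From mathcomp Require Import all_boot all_order all_algebra.
From mathcomp Require Import boolp.
From mathcomp Require Import zify ring.

Set Implicit Arguments.
Unset Strict Implicit.
Unset Printing Implicit Defensive.

(** * Closure properties of mu-recursive functions *)

Section MuRec.

Local Notation "s `_ i" := (nth 0 s i) : nat_scope.

(* An argument list has length k; on lists of another length f is irrelevant. *)
Definition computable k (f : seq nat -> nat) : Prop :=
  exists p : murec k, forall v : k.-tuple nat, computes p v (f v).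

Lemma eq_computable k (f g : seq nat -> nat) :
  (forall s, f s = g s) -> computable k f -> computable k g.
Proof. by move=> fg [p Pp]; exists p => v; rewrite -fg. Qed.

Lemma computable_nth k i : (i < k)%N -> computable k (fun s => s`_i).
Proof.
by move=> ik; exists (Proj (Ordinal ik)) => v /=; rewrite (tnth_nth 0).
Qed.

Lemma computable0 k : computable k (fun _ => 0).
Proof. by exists (Zero k). Qed.

Lemma computable_comp k (gs : seq (seq nat -> nat)) (f : seq nat -> nat) :
  computable (size gs) f ->
  (forall i, (i < size gs)%N -> computable k (nth (fun=> 0) gs i)) ->
  computable k (fun s => f [seq g s | g <- gs]).
Proof.
move=> [p Pp] gsP.
(* [Comp] takes its components as a function on ordinals, while the programs are only known to
   exist; one is chosen for each index. *)
have [q Pq] := choice (fun i : 'I_(size gs) => gsP i (ltn_ord i)).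
exists (Comp p q) => v /=.
exists (map_tuple (fun g : seq nat -> nat => g v) (in_tuple gs)); split=> [i|].
  by rewrite tnth_map (tnth_nth (fun=> 0)); exact: Pq.
exact: (Pp (map_tuple (fun g : seq nat -> nat => g v) (in_tuple gs))).
Qed.

Lemma computable_op1 k (h : nat -> nat) f :
  computable 1 (fun s => h s`_0) -> computable k f ->
  computable k (fun s => h (f s)).
Proof.
by move=> hC fC; apply: (computable_comp (gs := [:: f]) hC) => -[].
Qed.

Lemma computable_op2 k (h : nat -> nat -> nat) f0 f1 :
  computable 2 (fun s => h s`_0 s`_1) -> computable k f0 -> computable k f1 ->
  computable k (fun s => h (f0 s) (f1 s)).
Proof.
move=> hC C0 C1; apply: (computable_comp (gs := [:: f0; f1]) hC).
by move=> [|[]].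
Qed.

Lemma computable_op3 k (h : nat -> nat -> nat -> nat) f0 f1 f2 :
  computable 3 (fun s => h s`_0 s`_1 s`_2) ->
  computable k f0 -> computable k f1 -> computable k f2 ->
  computable k (fun s => h (f0 s) (f1 s) (f2 s)).
Proof.
move=> hC C0 C1 C2; apply: (computable_comp (gs := [:: f0; f1; f2]) hC).
by move=> [|[|[]]].
Qed.

Lemma computable_succ k f : computable k f -> computable k (fun s => (f s).+1).
Proof.
apply: (@computable_op1 k succn f).
by exists Succ => v /=; rewrite /thead (tnth_nth 0).
Qed.

Lemma computable_const k c : computable k (fun _ => c).
Proof.
by elim: c => [|c IHc]; [exact: computable0 | exact: computable_succ IHc].
Qed.

(** The step takes the index before the accumulator, the order in which [Prec] passes them. *)
Fixpoint iterate (b : nat) (F : nat -> nat -> nat) (m : nat) : nat :=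
  if m is i.+1 then F i (iterate b F i) else b.

Lemma computable_reindex k m (js : seq nat) (f : seq nat -> nat) :
  size js = k -> all (fun j => (j < m)%N) js -> computable k f ->
  computable m (fun s => f [seq s`_j | j <- js]).
Proof.
move=> szj /allP jm; pose projs := [seq (fun s : seq nat => s`_j) | j <- js].
have szp : size projs = k by rewrite size_map.
rewrite -szp => fC.
apply: eq_computable (computable_comp fC (k := m) _) => [s|].
  by rewrite -map_comp.
move=> i; rewrite size_map => ij; rewrite (nth_map 0) //.
exact/computable_nth/jm/mem_nth.
Qed.

Lemma map_nth_tuple k (v : k.-tuple nat) : [seq v`_j | j <- iota 0 k] = v.
Proof. by rewrite -[RHS](mkseq_nth 0) size_tuple. Qed.

Lemma computable_iterate k m b (F : seq nat -> nat) :
  computable k m -> computable k b -> computable k.+2 F ->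
  computable k
    (fun s => iterate (b s) (fun i acc => F [:: i, acc & s]) (m s)).
Proof.
move=> mC [p Pp] [q Pq].
pose projs := [seq (fun s : seq nat => s`_i) | i <- iota 0 k].
(* [Prec] recurses on its first argument, so the bound becomes an extra leading argument, for which
   [m] is then substituted. *)
pose h s := iterate (b (behead s)) (fun i acc => F [:: i, acc & behead s]) s`_0.
have sz : size (m :: projs) = k.+1 by rewrite /= size_map size_iota.
have hC : computable k.+1 h.
  exists (Prec p q) => v /=; have -> : thead v = v`_0.
    by rewrite /thead (tnth_nth 0).
  exists (iterate (b (behead v)) (fun i acc => F [:: i, acc & behead v])).
  split=> [|i _|]; [exact: (Pp (behead_tuple v)) | | by []].
  exact: (Pq (cons_tuple i (cons_tuple _ (behead_tuple v)))).
rewrite -sz in hC.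
have [|r Pr] := computable_comp hC (k := k).
  move=> [|i] //= ik; rewrite size_map size_iota ltnS in ik.
  rewrite (nth_map 0) ?size_iota // nth_iota // add0n.
  exact: computable_nth.
exists r => v; move: (Pr v); rewrite /= -map_comp /comp /h /=.
by rewrite map_nth_tuple.
Qed.

Lemma computable_add k f g :
  computable k f -> computable k g -> computable k (fun s => f s + g s).
Proof.
apply: (@computable_op2 k addn f g).
apply: eq_computable (computable_iterate (k := 2) (F := fun s => (s`_1).+1)
  (computable_nth (isT : 0 < 2)) (computable_nth (isT : 1 < 2)) _).
  by move=> s /=; elim: s`_0 => [|i IHi] //=; rewrite IHi.
exact/computable_succ/computable_nth.
Qed.

Lemma computable_sum k m (F : seq nat -> nat) :
  computable k m -> computable k.+1 F ->
  computable k (fun s => \sum_(i < m s) F ((i : nat) :: s)).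
Proof.
(* The list [js] skips position 1, which holds the accumulator of the recursion. *)
move=> mC FC; pose js := 0 :: iota 2 k.
have [|| p Pp] := @computable_reindex k.+1 k.+2 js F _ _ FC.
- by rewrite /= size_iota.
- by apply/allP => j; rewrite inE mem_iota; lia.
pose G := fun s => s`_1 + F [seq s`_j | j <- js].
have GC : computable k.+2 G.
  by apply: computable_add; [exact: computable_nth | exists p].
have [q Pq] := computable_iterate mC (computable_const k 0) GC.
exists q => v; move: (Pq v); congr computes.
elim: (m v) => [|i IHi]; first by rewrite big_ord0.
rewrite big_ord_recr /= IHi /G; congr (_ + F _) => /=; congr (_ :: _).
by rewrite (iotaDl 2 0) -map_comp -[RHS]map_nth_tuple.
Qed.

Lemma computable_mul k f g :
  computable k f -> computable k g -> computable k (fun s => f s * g s).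
Proof.
apply: (@computable_op2 k muln f g).
apply: eq_computable (computable_sum (k := 2) (F := fun s => s`_2)
  (computable_nth (isT : 0 < 2)) (computable_nth (isT : 2 < 3))) => s /=.
by rewrite sum_nat_const card_ord.
Qed.

Lemma computable_exp k f g :
  computable k f -> computable k g -> computable k (fun s => f s ^ g s).
Proof.
apply: (@computable_op2 k expn f g).
apply: eq_computable (computable_iterate (k := 2) (F := fun s => s`_2 * s`_1)
  (computable_nth (isT : 1 < 2)) (computable_const 2 1) _).
  by move=> s /=; elim: s`_1 => [|i IHi] //=; rewrite IHi expnS.
by apply: computable_mul; exact: computable_nth.
Qed.

Lemma computable_pred k f : computable k f -> computable k (fun s => (f s).-1).
Proof.
apply: (@computable_op1 k predn f).
apply: eq_computable (computable_iterate (k := 1) (F := fun s => s`_0)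
  (computable_nth (isT : 0 < 1)) (computable0 1) (computable_nth _)) => // s.
by case: s`_0.
Qed.

Lemma computable_sub k f g :
  computable k f -> computable k g -> computable k (fun s => f s - g s).
Proof.
apply: (@computable_op2 k subn f g).
apply: eq_computable (computable_iterate (k := 2) (F := fun s => (s`_1).-1)
  (computable_nth (isT : 1 < 2)) (computable_nth (isT : 0 < 2)) _).
  by move=> s /=; elim: s`_1 => [|i IHi] /=; rewrite ?subn0 // IHi subnS.
exact/computable_pred/computable_nth.
Qed.

Lemma computable_eq k f g :
  computable k f -> computable k g ->
  computable k (fun s => nat_of_bool (f s == g s)).
Proof.
move=> fC gC.
(* Equality holds iff both truncated differences vanish. *)
apply: eq_computable (computable_sub (computable_const k 1)
  (computable_add (computable_sub fC gC) (computable_sub gC fC))) => s /=.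
by case: (ltngtP (f s) (g s)); lia.
Qed.

Lemma computable_leq k f g :
  computable k f -> computable k g ->
  computable k (fun s => nat_of_bool (f s <= g s)).
Proof.
move=> fC gC; apply: computable_eq (computable_sub fC gC) _.
exact: computable0.
Qed.

Lemma sum_ltn k q : q <= k -> \sum_(i < k) (i < q) = q.
Proof.
elim: k => [|k IHk]; first by rewrite big_ord0 leqn0 => /eqP.
rewrite big_ord_recr /= leq_eqVlt => /orP[/eqP->|]; last first.
  by rewrite ltnS => qk; rewrite IHk // ltnNge qk addn0.
rewrite leqnn addn1; congr _.+1.
under eq_bigr => i _ do rewrite ltnS (ltnW (ltn_ord i)).
by rewrite sum_nat_const card_ord muln1.
Qed.

(** The quotient counts the positive multiples of d up to m, which makes division a bounded sum; the
    factor [0 < d] matches the convention [m %/ 0 = 0]. *)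
Lemma divn_sum m d : m %/ d = \sum_(i < m) (0 < d) * (i.+1 * d <= m).
Proof.
case: d => [|d]; first by rewrite divn0 big1.
under eq_bigr do rewrite mul1n -leq_divRL //.
by rewrite sum_ltn ?leq_div.
Qed.

Lemma computable_div k f g :
  computable k f -> computable k g -> computable k (fun s => f s %/ g s).
Proof.
apply: (@computable_op2 k divn f g).
have i0 := computable_nth (isT : 0 < 3).
have i1 := computable_nth (isT : 1 < 3).
have i2 := computable_nth (isT : 2 < 3).
apply: eq_computable (computable_sum (computable_nth (isT : 0 < 2))
  (computable_mul (computable_leq (computable_const 3 1) i2)
    (computable_leq (computable_mul (computable_succ i0) i2) i1))) => s.
exact/esym/divn_sum.
Qed.

Lemma computable_dvdn k f g :
  computable k f -> computable k g ->
  computable k (fun s => nat_of_bool (f s %| g s)).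
Proof.
move=> fC gC; apply: eq_computable
  (computable_eq (computable_mul (computable_div gC fC) fC) gC) => s.
by rewrite dvdn_eq.
Qed.

End MuRec.

(** * The affine model of BS(1,n) *)

Section IntegerPowers.
Import Order.TTheory GRing.Theory Num.Theory.
Local Open Scope ring_scope.

Lemma zexpgS (G : groupType) (g : G) k : (g * zexpg g k)%g = zexpg g (1 + k).
Proof.
case: k => [k|[|k]].
- by rewrite -[1 + _]/(Posz k.+1) /= expgS.
- by rewrite /= mulgV.
have -> : 1 + Negz k.+1 = Negz k by lia.
by rewrite /= [(g ^+ k.+2)%g]expgSr invgM mulVKg.
Qed.

Lemma zexpgD (G : groupType) (g : G) k l :
  zexpg g (k + l) = (zexpg g k * zexpg g l)%g.
Proof.
elim/int_rec: k => [|k IHk|k IHk]; first by rewrite add0r mul1g.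
  by rewrite intS -addrA -!zexpgS IHk mulgA.
apply: (mulgI g); rewrite mulgA !zexpgS addrA intS.
by rewrite (_ : 1 - (1 + k%:Z) = - k%:Z) //; lia.
Qed.

Lemma zexpgN (G : groupType) (g : G) k : zexpg g (- k) = (zexpg g k)^-1%g.
Proof. by apply: (mulgI (zexpg g k)); rewrite -zexpgD mulgV addrN. Qed.

Lemma zexpg_expg (G : groupType) (g : G) m k :
  zexpg (g ^+ m)%g k = zexpg g (m%:Z * k).
Proof.
case: k => k; rewrite ?NegzE ?mulrN ?zexpgN -?PoszM /=; last first.
  by congr (_^-1)%g; rewrite -expgnA.
by rewrite -expgnA.
Qed.

Lemma zexpg_intertwine (G : groupType) (x g h : G) k :
  (x * g = h * x)%g -> (x * zexpg g k = zexpg h k * x)%g.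
Proof.
move=> xg; have {}xg m : (x * g ^+ m = h ^+ m * x)%g.
  elim: m => [|m IHm]; first by rewrite !expg0 mul1g mulg1.
  by rewrite !expgS mulgA xg -mulgA IHm mulgA.
case: k => k /=; first exact: xg.
by apply: (mulgI (h ^+ k.+1)%g); rewrite mulVKg mulgA -xg mulgK.
Qed.

End IntegerPowers.

Section Affine.
Import Order.TTheory GRing.Theory Num.Theory.
Local Open Scope ring_scope.
Variable n : nat.
Hypothesis n2 : (2 <= n)%N.

Local Notation N := (n%:R : rat).

Lemma base_neq0 : N != 0.
Proof. by rewrite pnatr_eq0; lia. Qed.

Lemma base_gt1 : 1 < N.
Proof. by rewrite ltr1n. Qed.

(** The pair (x, k) is the affine map z -> x + n^k z, and the product is composition. Coordinates
    lie in Q; [aval_Zinv] and [aval_surj] show that exactly Z[1/n] is reached. *)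
Definition amul (p q : rat * int) : rat * int :=
  (p.1 + N ^ p.2 * q.1, p.2 + q.2).

Lemma amulA : associative amul.
Proof.
move=> [x k] [y l] [z m]; rewrite /amul /= addrA expfzDr ?base_neq0 //.
by congr (_, _); ring.
Qed.

Lemma amul0 p : amul (0, 0) p = p.
Proof. by case: p => x k; rewrite /amul /= expr0z mul1r !add0r. Qed.

Definition aletter (x : letter) : rat * int :=
  let s : int := if x.2 then -1 else 1 in
  if x.1 then (0, s) else (s%:~R, 0).

Definition aword (w : word) : rat * int :=
  foldr (fun x p => amul (aletter x) p) (0, 0) w.

Lemma aword_cat v w : aword (v ++ w) = amul (aword v) (aword w).
Proof. by elim: v => [|x v IHv] /=; rewrite ?amul0 // IHv amulA. Qed.

Lemma aword_nseq_a m b :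
  aword (nseq m (false, b)) = ((-1) ^+ b * m%:R, 0).
Proof.
elim: m => [|m IHm] /=; first by rewrite mulr0.
rewrite IHm /amul /aletter /= expr0z mul1r -[m.+1]add1n natrD mulrDr mulr1.
by case: b {IHm}.
Qed.

Lemma aword_eq v w : bs_eq n v w -> aword v = aword w.
Proof.
elim=> {v w} //.
- by move=> u v w _ -> _ ->.
- by move=> u u' v v' _ eu _ ev; rewrite !aword_cat eu ev.
- case=> -[] [] /=; rewrite /amul /aletter /= ?expr0z ?mulr0 ?mul1r ?addr0;
    by rewrite ?addrN ?addNr ?rmorphN /= ?addrN ?addNr.
rewrite (aword_nseq_a n false) /= /amul /aletter /= expr1z.
by rewrite ?(mulr0, addr0, add0r, mulr1, expr0, mul1r).
Qed.

Definition aval (g : BS n) : rat * int := aword (repr g).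

Lemma aval_word w : aval (of_word n w) = aword w.
Proof. exact/aword_eq/bs_repr. Qed.

Lemma avalM g h : aval (g * h)%g = amul (aval g) (aval h).
Proof. by rewrite -[(g * h)%g]/(of_word n _) aval_word aword_cat. Qed.

Lemma aval1 : aval 1%g = (0, 0).
Proof. exact: aval_word. Qed.

Lemma aval_a : aval (bs_a n) = (1, 0).
Proof. by rewrite aval_word /= /amul /= mulr0 !addr0. Qed.

Lemma aval_t : aval (bs_t n) = (0, 1).
Proof. by rewrite aval_word /= /amul /= mulr0 !addr0. Qed.

Lemma avalV g : aval g^-1%g = (- N ^ (- (aval g).2) * (aval g).1, - (aval g).2).
Proof.
have := avalM g^-1%g g; rewrite mulVg aval1 /amul.
case: (aval g^-1%g) (aval g) => [x k] [y l] /= [ex ek].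
have kl : k = - l by lia.
rewrite kl mulNr in ex *; congr (_, _); apply/eqP.
by rewrite -addr_eq0 ex.
Qed.

Lemma aval_expg g k : (aval (g ^+ k)%g).2 = (aval g).2 *+ k.
Proof.
by elim: k => [|k IHk]; rewrite ?aval1 // expgS avalM /= IHk mulrS.
Qed.

Lemma aval_zexpg g k : (aval (zexpg g k)).2 = (aval g).2 * k.
Proof.
case: k => k /=; last rewrite avalV /=; rewrite aval_expg.
  by rewrite -mulr_natr natz.
by rewrite NegzE -mulr_natr natz mulrN.
Qed.

Lemma tpow_apow m k :
  (bs_t n ^+ m * zexpg (bs_a n) k =
   zexpg (bs_a n) (n%:Z ^+ m * k) * bs_t n ^+ m)%g.
Proof.
elim: m k => [|m IHm] k; first by rewrite !expg0 mul1g mulg1 expr0 mul1r.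
rewrite expgS -mulgA IHm mulgA.
rewrite (zexpg_intertwine (h := (bs_a n ^+ n)%g)) ?bs_relation //.
  by rewrite zexpg_expg exprS mulrA -mulgA.
by rewrite -bs_relation mulgVK.
Qed.

Lemma apow_tpowV m k :
  (zexpg (bs_a n) k * bs_t n ^- m =
   bs_t n ^- m * zexpg (bs_a n) (n%:Z ^+ m * k))%g.
Proof.
by apply: (mulgI (bs_t n ^+ m)%g); rewrite mulgA tpow_apow mulgK mulVKg.
Qed.

Lemma bs_ind (P : BS n -> Prop) :
  P 1%g -> (forall g, P g -> P (bs_a n * g)%g) ->
  (forall g, P g -> P ((bs_a n)^-1 * g)%g) ->
  (forall g, P g -> P (bs_t n * g)%g) ->
  (forall g, P g -> P ((bs_t n)^-1 * g)%g) -> forall g, P g.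
Proof.
move=> P1 Pa PA Pt PT g; rewrite -(of_word_repr g).
elim: (repr g) => [|x w IHw] //; rewrite -cat1s -bs_mulE.
have aV : (bs_a n)^-1%g = of_word n [:: inv_letter letter_a] by exact: bs_invE.
have tV : (bs_t n)^-1%g = of_word n [:: inv_letter letter_t] by exact: bs_invE.
rewrite aV in PA; rewrite tV in PT.
by case: x => -[] []; [exact: PT | exact: Pt | exact: PA | exact: Pa].
Qed.

Definition normal_form m (j : int) p : BS n :=
  (bs_t n ^- m * zexpg (bs_a n) j * bs_t n ^+ p)%g.

(** Left multiplication by a letter preserves the shape: a or a^-1 crosses t^-m and becomes a power
    with exponent n^m or -n^m; t cancels against t^-m or, when m = 0, crosses the power of a; t^-1
    lengthens t^-m. *)
Lemma normal_formP g : exists m j p, g = normal_form m j p.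
Proof.
rewrite /normal_form.
elim/bs_ind: g => [|_ [m [j [p ->]]]|_ [m [j [p ->]]]|_ [m [j [p ->]]]|
                   _ [m [j [p ->]]]].
- by exists 0%N, 0, 0%N; rewrite !expg0 invg1 !mul1g.
- exists m, (n%:Z ^+ m * 1 + j), p; rewrite !mulgA; congr (_ * _)%g.
  by rewrite -[bs_a n in LHS]/(zexpg _ 1) apow_tpowV zexpgD mulgA.
- exists m, (n%:Z ^+ m * (-1) + j), p; rewrite !mulgA; congr (_ * _)%g.
  rewrite (_ : (bs_a n)^-1%g = zexpg (bs_a n) (-1)) //.
  by rewrite apow_tpowV zexpgD mulgA.
- case: m => [|m].
    exists 0%N, (n%:Z ^+ 1 * j), p.+1; rewrite !expg0 invg1 !mul1g mulgA.
    by rewrite -{1}[bs_t n]expg1 tpow_apow expg1 expgS mulgA.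
  by exists m, j, p; rewrite !mulgA expgSr invgM mulVKg.
- by exists m.+1, j, p; rewrite !mulgA expgSr invgM.
Qed.

Lemma aval_apow k : aval (zexpg (bs_a n) k) = (k%:~R, 0).
Proof.
have aX m : aval (bs_a n ^+ m)%g = (m%:R, 0).
  elim: m => [|m IHm]; first exact: aval1.
  rewrite expgS avalM IHm aval_a /amul /= expr0z mul1r addr0.
  by rewrite -[m.+1]add1n natrD.
case: k => k /=; rewrite ?avalV aX //=.
by rewrite oppr0 expr0z mulN1r NegzE.
Qed.

Lemma aval_tpow m : aval (bs_t n ^+ m)%g = (0, m%:Z).
Proof.
elim: m => [|m IHm]; first exact: aval1.
by rewrite expgS avalM IHm aval_t /amul /= mulr0 addr0 intS.
Qed.

Lemma aval_normal_form m j p :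
  aval (normal_form m j p) = (j%:~R / N ^+ m, p%:Z - m%:Z).
Proof.
rewrite /normal_form !avalM avalV !aval_tpow aval_apow /amul /=.
by rewrite !mulr0 add0r addr0 addr0 addrC mulrC -exprnN.
Qed.

(** On a normal form, value zero forces j = 0 and p = m, so the product collapses. This makes the
    affine model faithful. *)
Lemma aval_eq1 g : aval g = (0, 0) -> g = 1%g.
Proof.
have [m [j [p ->]]] := normal_formP g; rewrite aval_normal_form => -[].
move=> /eqP; rewrite mulf_eq0 invr_eq0 expf_eq0 (negPf base_neq0) andbF orbF.
rewrite intr_eq0 => /eqP-> pm; have -> : p = m by lia.
by rewrite /normal_form /= mulg1 mulVg.
Qed.

Lemma aval_inj : injective aval.
Proof.
move=> g h gh; apply/divg1_eq/aval_eq1.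
by rewrite avalM gh -avalM mulgV aval1.
Qed.

Lemma aval_Zinv g : (aval g).1 \in Zinv n.
Proof.
have [m [j [p ->]]] := normal_formP g; rewrite aval_normal_form.
by apply/asboolP; exists j, m.
Qed.

Lemma Zinv_div x : x \in Zinv n -> N^-1 * x \in Zinv n.
Proof.
move=> /asboolP[l [m ->]]; apply/asboolP; exists l, m.+1.
by rewrite mulrCA exprS invfM.
Qed.

Lemma aval_surj x k : x \in Zinv n -> exists g, aval g = (x, k).
Proof.
move=> /asboolP[l [m ->]].
exists (normal_form m l m * zexpg (bs_t n) k)%g.
have tk : aval (zexpg (bs_t n) k) = (0, k).
  case: k => k /=; rewrite ?avalV aval_tpow //=.
  by rewrite mulr0 NegzE.
by rewrite avalM tk aval_normal_form /amul /= mulr0 addr0 addrN add0r.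
Qed.

End Affine.

(** * Endomorphisms and their fixed subgroups *)

Section Morphism.
Local Open Scope group_scope.
Variables (G H : groupType) (f : {multiplicative G -> H}).

Lemma mulmorph1 : f 1 = 1.
Proof. by apply: (mulgI (f 1)); rewrite -gmulfM !mulg1. Qed.

Lemma mulmorphV x : f x^-1 = (f x)^-1.
Proof. by apply: (mulgI (f x)); rewrite -gmulfM !mulgV mulmorph1. Qed.

Lemma mulmorphX m x : f (x ^+ m) = f x ^+ m.
Proof.
by elim: m => [|m IHm]; rewrite ?mulmorph1 // !expgS gmulfM IHm.
Qed.

Lemma mulmorphZ k x : f (zexpg x k) = zexpg (f x) k.
Proof. by case: k => k /=; rewrite ?mulmorphV mulmorphX. Qed.

End Morphism.

Section Endomorphism.
Import Order.TTheory GRing.Theory Num.Theory.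
Local Open Scope ring_scope.
Variable n : nat.
Hypothesis n2 : (2 <= n)%N.
Variable phi : {multiplicative BS n -> BS n}.

Local Notation N := (n%:R : rat).
Local Notation pa := (phi (bs_a n)).
Local Notation pt := (phi (bs_t n)).
Let N0 : N != 0 := base_neq0 n2.
Let N1 : N - 1 != 0.
Proof. by rewrite subr_eq0 gt_eqF ?base_gt1. Qed.

Lemma endo_relation : (pt * pa = pa ^+ n * pt)%g.
Proof. by rewrite -mulmorphX -!gmulfM -bs_relation mulgVK. Qed.

(** The second component (the height) is additive, so [endo_relation] gives k = n k for the height k
    of the image of a. *)
Lemma endo_a_expt : (aval pa).2 = 0.
Proof.
have := congr1 (fun g => (aval g).2) endo_relation.
rewrite !(avalM n2) /= (aval_expg n2) [LHS]addrC => /addIr.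
rewrite -mulr_natr natz; nia.
Qed.

Lemma aval_expg0 (g : BS n) m :
  (aval g).2 = 0 -> (aval (g ^+ m)%g).1 = m%:R * (aval g).1.
Proof.
move=> g0; elim: m => [|m IHm]; first by rewrite (aval1 n2) mul0r.
by rewrite expgS (avalM n2) /= g0 IHm expr0z -[m.+1]add1n natrD; ring.
Qed.

(** The first components in [endo_relation] give (n^l - n) x = 0, and powers of n > 1 have distinct
    exponents. *)
Lemma endo_cases : (aval pa).1 = 0 \/ (aval pt).2 = 1.
Proof.
have := congr1 (fun g => (aval g).1) endo_relation.
rewrite !(avalM n2) /= (aval_expg n2) (aval_expg0 _ endo_a_expt) endo_a_expt.
rewrite mul0rn expr0z mul1r addrC => /addIr/eqP.
rewrite -subr_eq0 -mulrBl mulf_eq0 => /orP[|/eqP]; last by left.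
rewrite subr_eq0 -[X in _ == X]expr1z => /eqP lN; right.
by apply: (ieexprIz _ _ lN); [rewrite ltr0n; lia | rewrite gt_eqF ?base_gt1].
Qed.

(** The image of a is trivial, so the endomorphism factors through the height. *)
Lemma endo_degenerate g : (aval pa).1 = 0 -> phi g = zexpg pt (aval g).2.
Proof.
move=> x0; have pa1 : pa = 1%g.
  by apply: (aval_eq1 n2); rewrite -endo_a_expt -x0; case: (aval pa).
elim/(bs_ind): g => [|g IHg|g IHg|g IHg|g IHg].
- by rewrite (aval1 n2) mulmorph1.
- by rewrite gmulfM pa1 mul1g IHg (avalM n2) (aval_a n2) /= add0r.
- rewrite gmulfM mulmorphV pa1 invg1 mul1g IHg.
  by rewrite (avalM n2) (avalV n2) (aval_a n2) /= oppr0 add0r.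
- by rewrite gmulfM IHg (avalM n2) (aval_t n2) /= zexpgS.
- rewrite gmulfM mulmorphV IHg (avalM n2) (avalV n2) (aval_t n2) /=.
  by rewrite zexpgD.
Qed.

(** The quotient is the geometric sum 1 + n + ... + n^(k-1) coming from (y, 1)^k, in a form that
    also covers negative k. *)
Lemma aval_endo g : (aval pt).2 = 1 ->
  aval (phi g) = ((aval pa).1 * (aval g).1 +
    (aval pt).1 * ((N ^ (aval g).2 - 1) / (N - 1)), (aval g).2).
Proof.
move=> t1; have pax : aval pa = ((aval pa).1, 0).
  by rewrite -endo_a_expt; case: (aval pa).
have pty : aval pt = ((aval pt).1, 1) by rewrite -t1; case: (aval pt).
move: (aval pa).1 (aval pt).1 pax pty => x y pax pty.
elim/(bs_ind): g => [|g IHg|g IHg|g IHg|g IHg].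
- by rewrite mulmorph1 !(aval1 n2) /= expr0z subrr !mul0r !mulr0 addr0.
- rewrite gmulfM !(avalM n2) IHg pax (aval_a n2) /amul /= !add0r expr0z.
  by rewrite !mul1r addrA mulrDr mulr1.
- rewrite gmulfM mulmorphV !(avalM n2) !(avalV n2) IHg pax (aval_a n2) /amul /=.
  by rewrite !oppr0 !add0r expr0z !mul1r addrA mulrDr mulr1 [x * -1]mulrC.
- rewrite gmulfM !(avalM n2) IHg pty (aval_t n2) /amul /= expfzDr // expr1z.
  congr (_, _); rewrite add0r; move: (N ^ _) (aval g).1 => e z.
  by move: (N) N1 => M M1; field.
- rewrite gmulfM mulmorphV !(avalM n2) !(avalV n2) IHg pty (aval_t n2) /amul /=.
  rewrite expfzDr // exprN1; congr (_, _); move: (N ^ _) (aval g).1 => e z.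
  by move: (N) N0 N1 => M M0 M1; field; apply/andP.
Qed.

Lemma fixg_degenerate g :
  (aval pa).1 = 0 -> g \in fixg phi <-> g = zexpg pt (aval g).2.
Proof.
move=> x0; rewrite inE; split=> [/eqP e|e].
  by rewrite -{1}e; exact: endo_degenerate.
by apply/eqP; rewrite [RHS]e; exact: endo_degenerate.
Qed.

(** The height is preserved, so only the first component imposes a condition; the factor n - 1
    clears the denominator of the geometric sum. *)
Lemma fixgP g : (aval pt).2 = 1 ->
  g \in fixg phi <->
  (1 - (aval pa).1) * (N - 1) * (aval g).1 =
    (aval pt).1 * (N ^ (aval g).2 - 1).
Proof.
move=> t1; rewrite inE; split=> [/eqP gfix | eg].
  have := congr1 (fun g => (aval g).1) gfix; rewrite (aval_endo g) //=.
  move: (N ^ (aval g).2 - 1) (aval g).1 (aval pa).1 (aval pt).1 => S z x y.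
  move: (N - 1) N1 => M M1 e.
  have -> : y * S = y * (S / M) * M by field.
  have -> : y * (S / M) = z - x * z.
    by apply/eqP; rewrite eq_sym subr_eq addrC e.
  by ring.
apply/eqP/(aval_inj n2); rewrite (aval_endo g) // mulrA -eg.
case: (aval g) => z k /=; congr (_, _).
by move: (N - 1) N1 (aval pa).1 => M M1 x; field.
Qed.

Lemma endo_id : (aval pa).1 = 1 -> aval pt = (0, 1) -> phi =1 id.
Proof.
move=> x1 t1 g; apply/(aval_inj n2); rewrite aval_endo t1 //=.
by rewrite x1 mul1r mul0r addr0; case: (aval g).
Qed.

(** Euclidean division of heights: dividing g by a power of [g0] leaves a fixed element whose height
    is the remainder. By minimality that height is 0, so the element is trivial. *)
Lemma generates_min g0 :
  (forall g, g \in fixg phi -> (aval g).2 = 0 -> g = 1%g) ->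
  g0 \in fixg phi -> 0 < (aval g0).2 ->
  (forall g, g \in fixg phi -> 0 < (aval g).2 -> (aval g0).2 <= (aval g).2) ->
  generates g0 (fixg phi).
Proof.
move=> ker0 fix0 pos0 min0 g.
have fixZ k : phi (zexpg g0 k) = zexpg g0 k.
  by rewrite mulmorphZ (eqP (fix0 : phi g0 == g0)).
split=> [gfix|[k ->]]; last by rewrite inE fixZ.
pose k := ((aval g).2 %/ (aval g0).2)%Z; exists k.
pose r := (g * zexpg g0 (- k))%g.
have fixr : r \in fixg phi by rewrite inE gmulfM fixZ (eqP (gfix : phi g == g)).
have avr : (aval r).2 = ((aval g).2 %% (aval g0).2)%Z.
  by rewrite (avalM n2) /= (aval_zexpg n2) /k /modz mulrN mulrC.
have r0 : (aval r).2 = 0.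
  have [|/min0] := leP (aval r).2 0.
    by rewrite avr => r_le0; apply/eqP; rewrite eq_le r_le0 modz_ge0 // gt_eqF.
  by move=> /(_ fixr); rewrite leNgt avr ltz_pmod.
by move: (ker0 _ fixr r0); rewrite /r zexpgN => /divg1_eq.
Qed.

End Endomorphism.

(** * Recognizing Z and Z[1/n] among fixed subgroups *)

Section Isomorphism.
Import Order.TTheory GRing.Theory Num.Theory.
Local Open Scope ring_scope.
Variable n : nat.
Hypothesis n2 : (2 <= n)%N.
Variable phi : {multiplicative BS n -> BS n}.

Local Notation fixT := (fix_group phi).
Local Notation intG := (Algebra.to_multiplicative int).

Lemma fix_valM (g h : fixT) : fix_val (g * h)%g = (fix_val g * fix_val h)%g.
Proof. by []. Qed.

Lemma fix_valX (g : fixT) m : fix_val (g ^+ m)%g = (fix_val g ^+ m)%g.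
Proof. by elim: m => // m IHm; rewrite !expgS fix_valM IHm. Qed.

(** Every fixed element is a power of [g0], and its exponent is an exact quotient of heights. *)
Lemma isomorphic_int g0 : (aval g0).2 != 0 -> generates g0 (fixg phi) ->
  isomorphic_groups fixT intG.
Proof.
move=> d0 gen.
pose f (h : fixT) : intG := ((aval (fix_val h)).2 %/ (aval g0).2)%Z.
have fE h k : fix_val h = zexpg g0 k -> f h = k.
  by move=> hk; rewrite /f hk (aval_zexpg n2) mulKz.
have fixZ k : zexpg g0 k \in fixg phi by apply/gen; exists k.
have fP h : fix_val h = zexpg g0 (f h).
  by have [k hk] := (gen _).1 (valP h); rewrite (fE h k hk).
have fM : {morph f : x y / (x * y)%g}.
  move=> x y; apply: fE; rewrite fix_valM {1}(fP x) {1}(fP y).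
  exact/esym/zexpgD.
pose F := HB.pack_for {multiplicative fixT -> intG} f
  (isMultiplicative.Build _ _ f fM).
exists F; exists (fun k => FixGroup (fixZ k)) => [h|k] /=.
  by apply: val_inj; rewrite /= -fP.
exact: fE.
Qed.

(** Elements of height 0 are translations, and composing translations adds their first
    components. *)
Lemma isomorphic_Zinv : (forall g, g \in fixg phi <-> (aval g).2 = 0) ->
  isomorphic_groups fixT (Algebra.to_multiplicative (Zinv_type n)).
Proof.
move=> fixE.
pose f (h : fixT) : Algebra.to_multiplicative (Zinv_type n) :=
  ZinvType (aval_Zinv n2 (fix_val h)).
have f0 (h : fixT) : (aval (fix_val h)).2 = 0 by apply/fixE; exact: valP.
have fM : {morph f : x y / (x * y)%g}.
  move=> x y; apply: val_inj => /=.
  by rewrite (avalM n2) /= f0 expr0z mul1r.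
pose F := HB.pack_for {multiplicative fixT -> _} f
  (isMultiplicative.Build _ _ f fM).
exists F.
have ex (z : Zinv_type n) : exists g : BS n, aval g = (Zinv_val z, 0).
  by apply: (aval_surj n2); exact: valP.
have [u uP] := choice ex.
have ufix z : u z \in fixg phi by apply/fixE; rewrite uP.
exists (fun z => FixGroup (ufix z)) => [h|z] /=; apply: val_inj => /=.
  by apply: (aval_inj n2); rewrite uP /= -(f0 h) -surjective_pairing.
by rewrite uP.
Qed.

(* The image of 1 is not an n-th power, whereas Z[1/n] is n-divisible; this
   separates the two infinite cases. *)
Lemma isomorphic_int_ker :
  isomorphic_groups fixT intG ->
  exists g, [/\ g \in fixg phi, g <> 1%g &
    ~ exists2 h, h \in fixg phi & (h ^+ n)%g = g].
Proof.
move=> [f [f' fK f'K]]; exists (fix_val (f' 1)); split; first exact: valP.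
  move=> e; have e1 : f' 1 = 1%g by apply: val_inj.
  by have := f'K 1; rewrite e1 mulmorph1.
move=> [h hfix hn].
have := f'K 1; have <- : (FixGroup hfix ^+ n)%g = f' 1.
  by apply: val_inj; rewrite /= fix_valX hn.
rewrite mulmorphX.
have -> : forall (x : intG) m, (x ^+ m)%g = (x : int) *+ m.
  by move=> x; elim=> // m IHm; rewrite expgS IHm mulrS.
rewrite -mulr_natr natz => /(congr1 absz)/eqP.
by rewrite abszM muln_eq1 => /andP[_ /eqP]; lia.
Qed.

End Isomorphism.

(** * Least exponents and decoding of words *)

Section Arithmetic.

(** Pigeonhole: among the exponents 0, ..., q two, i < j, give the same residue. Multiplying by n^(q
    - i) moves the coincidence to exponent q, with period j - i. *)
Lemma expn_eventually_periodic n q : 0 < q ->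
  exists p, [/\ 0 < p, p <= q & n ^ (q + p) = n ^ q %[mod q]].
Proof.
move=> q0; pose f (i : 'I_q.+1) : 'I_q := Ordinal (ltn_pmod (n ^ i) q0).
have /injectivePn[i [j ij fij]] : ~~ injectiveb f.
  by apply/injectiveP => /leq_card; rewrite !card_ord ltnn.
have eij : n ^ i = n ^ j %[mod q] by exact: (congr1 val fij).
wlog lt_ij : i j ij fij eij / i < j => [IH|].
  have [|ji|/val_inj/eqP] := ltngtP i j; [exact: IH | | by rewrite (negPf ij)].
  by apply: (IH j i) => //; rewrite eq_sym.
have := ltn_ord j; have := ltn_ord i; rewrite !ltnS => iq jq.
exists (j - i); split; [lia | lia |].
have -> : q + (j - i) = (q - i) + j by lia.
by rewrite expnD -modnMmr -eij modnMmr -expnD subnK.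
Qed.

(** Adding r periods to the exponent q keeps the residue and makes the exponent at least r. Thus
    exponent q decides whether some power of n clears the denominator q. *)
Lemma dvdn_expn_stable n q r m : 0 < q -> q %| n ^ r * m -> q %| n ^ q * m.
Proof.
move=> q0 qm; have [p [p0 _ ep]] := expn_eventually_periodic n q0.
have eps s : n ^ (q + s * p) = n ^ q %[mod q].
  elim: s => [|s IHs]; first by rewrite addn0.
  by rewrite mulSn addnA expnD -modnMml ep modnMml -expnD.
rewrite /dvdn -modnMml -(eps r) modnMml.
have -> : q + r * p = (q + r * p - r) + r by nia.
by rewrite expnD -mulnA -/(dvdn _ _) dvdn_mull.
Qed.

(* The least element of P below q, or q if there is none: the i-th term is 1 iff
   P fails on all of 0, ..., i. *)
Definition least (P : pred nat) q := \sum_(i < q) (\sum_(j < i.+1) P j == 0).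

Lemma leastP (P : pred nat) q i : i < q -> P i ->
  P (least P q) /\ forall j, P j -> least P q <= j.
Proof.
move=> iq Pi; have exP : exists i, P i by exists i.
case: (ex_minnP exP) => m Pm min_m.
have -> : least P q = m; last by [].
have mq : m <= q by exact: leq_trans (min_m i Pi) (ltnW iq).
(* Both sides count the k < m: the inner sum up to k vanishes exactly when k lies below the minimum
   m. *)
rewrite -[RHS](sum_ltn mq).
apply: eq_bigr => k _; congr nat_of_bool; rewrite sum_nat_eq0.
apply/forallP/idP => [k0|km j]; last first.
  by rewrite eqb0; apply/negP => /min_m; have := ltn_ord j; lia.
rewrite ltnNge; apply/negP => mk.
by have := k0 (Ordinal (mk : m < k.+1)); rewrite /= Pm.
Qed.

(** A period is a valid exponent and is at most q, so the search succeeds. The shift [j.+1] excludes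
    the exponent 0. *)
Lemma leastPn n q y : 0 < q ->
  let P j := q %| n ^ q * y * (n ^ j.+1 - 1) in
  P (least P q) /\ forall j, P j -> least P q <= j.
Proof.
move=> q0 P; have [[|p] [] // _ pq ep] := expn_eventually_periodic n q0.
suff Pp : P p by split; [exact: (leastP pq Pp).1 | exact: (leastP pq Pp).2].
rewrite /P mulnAC dvdn_mulr // mulnBr muln1 -expnD.
(* For n = 0 the truncated difference is 0; otherwise the difference is exact and the congruence
   applies. *)
case: n ep {P} => [|n] ep; first by rewrite exp0n ?addnS.
by rewrite -eqn_mod_dvd ?ep // leq_pexp2l ?leq_addr.
Qed.

End Arithmetic.

(** * Reading words off their codes *)

Section Decoding.

(** Digits run from 1 to 4, so the predecessor is taken before dividing; 0, the code of the empty
    word, is fixed. *)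
Definition rest c := c.-1 %/ 4.

(** Past the end of the word this is 0, the digit of no letter, so sums that run too far gain
    nothing. *)
Definition nth_digit i c := iter i rest c - 4 * rest (iter i rest c).

Definition occ d i c := \sum_(j < i) (nth_digit j c == d).

(* With d = 1 (resp. 3), the contribution of the letters a (resp. a^-1) to n^m
   times the Z[1/n]-component of the word of code c; the truncated subtraction
   is exact when m is at least the length of the word. *)
Definition part d m n k c :=
  \sum_(i < k) (nth_digit i c == d) * n ^ (m + occ 2 i c - occ 4 i c).

Lemma rest_code x w : rest (code (x :: w)) = code w.
Proof.
rewrite /rest /= -/(code w) addnC mulnC divnMDl // divn_small ?addn0 //.
by case: x => -[] [].
Qed.

Lemma nth_digit0 x w : nth_digit 0 (code (x :: w)) = digit x.
Proof. by rewrite /nth_digit [iter 0 _ _]/= rest_code /= addnK. Qed.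

Lemma nth_digitS i c : nth_digit i.+1 c = nth_digit i (rest c).
Proof. by rewrite /nth_digit iterSr. Qed.

Lemma nth_digit_nil i : nth_digit i 0 = 0.
Proof. by elim: i => // i IHi; rewrite nth_digitS. Qed.

Lemma occS d i x w :
  occ d i.+1 (code (x :: w)) = (digit x == d) + occ d i (code w).
Proof.
rewrite /occ big_ord_recl nth_digit0; congr (_ + _).
by apply: eq_bigr => j _; rewrite nth_digitS rest_code.
Qed.

(** A leading t or t^-1 shifts the exponents of all later terms; the shift stays inside the
    truncated subtraction, so no bound on m is required yet. *)
Lemma part_cons d m n k x w :
  part d m n k.+1 (code (x :: w)) =
  (digit x == d) * n ^ m + \sum_(i < k) (nth_digit i (code w) == d) *
    n ^ (m + ((digit x == 2) + occ 2 i (code w))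
           - ((digit x == 4) + occ 4 i (code w))).
Proof.
rewrite /part big_ord_recl nth_digit0 /occ !big_ord0 addn0 subn0; congr (_ + _).
by apply: eq_bigr => i _; rewrite -!/(occ _ _ _) !occS nth_digitS rest_code.
Qed.

(** Digits are at least 1, so the code itself is a computable bound on the length. *)
Lemma size_leq_code w : size w <= code w.
Proof. by elim: w => //= x w IHw; rewrite /digit; lia. Qed.

Lemma code_cat v w : code (v ++ w) = code v + 4 ^ size v * code w.
Proof.
elim: v => [|x v IHv] /=; first by rewrite mul1n.
by rewrite IHv expnS mulnDr addnA mulnA.
Qed.

Lemma code_nseq m x : code (nseq m x) = \sum_(i < m) digit x * 4 ^ i.
Proof.
elim: m => [|m IHm] /=; first by rewrite big_ord0.
rewrite IHm big_ord_recl muln1 big_distrr; congr (_ + _).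
by apply: eq_bigr => i _; rewrite expnS mulnCA.
Qed.

End Decoding.

Section AffineDecoding.
Import Order.TTheory GRing.Theory Num.Theory.
Local Open Scope ring_scope.
Variable n : nat.
Hypothesis n2 : (2 <= n)%N.
Local Notation N := (n%:R : rat).

(** Induction on w with m varying: a leading t multiplies the component of the tail by n, so the
    tail is read at m + 1, and a leading t^-1 at m - 1, which still bounds its length. *)
Lemma aword_part w m k : (size w <= m)%N -> (size w <= k)%N ->
  (aword n w).1 * N ^+ m =
  (part 1 m n k (code w))%:R - (part 3 m n k (code w))%:R.
Proof.
have N0 := base_neq0 n2.
elim: w m k => [|x w IHw] m k.
  by rewrite /part !big1 ?subrr ?mul0r // => i _; rewrite nth_digit_nil.
case: m k => [|m] [|k] //= wm wk; rewrite !ltnS in wm wk.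
have wm1 := leqW wm; have wm2 := leqW wm1.
rewrite -/(code (x :: w)) !part_cons; case: x => -[] [].
- rewrite /= /amul /aletter /= add0r exprS mulrACA mulVf // mul1r.
  rewrite (IHw m k) // /part !mul0n !add0n; congr (_%:R - _%:R);
  by apply: eq_bigr => i _; congr (_ * _ ^ _)%N; lia.
- rewrite /= /amul /aletter /= add0r mulrAC -exprS mulrC.
  rewrite (IHw m.+2 k) //.
  rewrite /part !mul0n !add0n; congr (_%:R - _%:R);
  by apply: eq_bigr => i _; congr (_ * _ ^ _)%N; lia.
- rewrite /= /amul /aletter /= mul1r mulrDl (IHw m.+1 k) //.
  rewrite mul0n mul1n add0n natrD natrX -/(part _ _ _ _ _); ring.
- rewrite /= /amul /aletter /= mul1r mulrDl (IHw m.+1 k) //.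
  rewrite mul0n mul1n add0n natrD natrX -/(part _ _ _ _ _); ring.
Qed.

End AffineDecoding.

(** * The generator and its computation *)

Definition fix_expt n q y :=
  (least (fun j => q %| n ^ q * y * (n ^ j.+1 - 1)) q).+1.

(** This is n^q |z| for the solution z of the fixed-point equation at height [fix_expt n q y]; the
    division is exact by [leastPn]. *)
Definition fix_num n q y := (n ^ q * y * (n ^ fix_expt n q y - 1)) %/ q.

(* t^-q a^(+-j) t^(q + k) is the element (+- j / n^q, k). *)
Definition fix_word n q y (neg : bool) : word :=
  nseq q (inv_letter letter_t) ++ nseq (fix_num n q y) (false, neg) ++
  nseq (q + fix_expt n q y) letter_t.

Section Generator.
Import Order.TTheory GRing.Theory Num.Theory.
Local Open Scope ring_scope.
Variable n : nat.
Hypothesis n2 : (2 <= n)%N.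
Local Notation N := (n%:R : rat).

Lemma aword_nseq_t m b :
  aword n (nseq m (true, b)) = (0, (-1) ^+ b * m%:Z).
Proof.
elim: m => [|m IHm] /=; first by rewrite mulr0.
rewrite IHm /amul /aletter /= mulr0 addr0 intS mulrDr mulr1.
by case: b {IHm}.
Qed.

Lemma aval_fix_word q y b :
  aval (of_word n (fix_word n q y b)) =
  ((-1) ^+ b * (fix_num n q y)%:R / N ^+ q, (fix_expt n q y)%:Z).
Proof.
rewrite (aval_word n2) /fix_word !(aword_cat n2).
rewrite (aword_nseq_t q true) aword_nseq_a (aword_nseq_t _ false).
rewrite /amul /= mulr0 addr0 add0r expr0 expr1 mul1r mulN1r -exprnN mulrC.
by congr (_, _); lia.
Qed.

Variable phi : {multiplicative BS n -> BS n}.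
Variables delta y : int.
Hypothesis delta0 : delta != 0.
Hypothesis fixE : forall g, g \in fixg phi <->
  delta%:~R * (N - 1) * (aval g).1 = y%:~R * (N ^ (aval g).2 - 1).

Let q := (n.-1 * `|delta|)%N.
Let q0 : (0 < q)%N.
Proof. by rewrite muln_gt0 absz_gt0 delta0 andbT; lia. Qed.

(** The integers [delta] and [y] stand for 1 - x and the first component of the image of t, scaled
    by a common power of n. At height 0, [delta != 0] forces z = 0; the sign of z is the product of
    the two signs. *)
Lemma generates_fix_word :
  generates (of_word n (fix_word n q `|y| ((delta < 0) (+) (y < 0))))
    (fixg phi).
Proof.
have N0 := base_neq0 n2.
have Nq0 r : N ^+ r != 0 by rewrite expf_neq0.
have N1 : N - 1 = n.-1%:R by rewrite -subn1 natrB // ltnW.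
have eqs (z : int) : z%:~R = (-1) ^+ (z < 0)%R * `|z|%N%:R :> rat.
  by rewrite {1}(intEsign z) rmorphM /= rmorph_sign.
have [kP k_min] := leastPn n `|y| q0.
have eJ : (fix_num n q `|y| * q = n ^ q * `|y| * (n ^ fix_expt n q `|y| - 1))%N.
  by rewrite /fix_num divnK.
have natX k : (n ^ k - 1)%:R = N ^ k%:Z - 1 :> rat.
  by rewrite natrB ?natrX // expn_gt0; lia.
apply: (generates_min n2).
- move=> g /fixE + g0; rewrite g0 expr0z subrr mulr0 => /eqP.
  rewrite !mulf_eq0 intr_eq0 (negPf delta0) N1 pnatr_eq0 /=.
  rewrite (_ : n.-1 == 0%N = false) /=; last by lia.
  by move=> /eqP x0; apply: (aval_eq1 n2); rewrite -g0 -x0; case: (aval g).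
- apply/fixE; rewrite aval_fix_word /= -natX N1 (eqs delta) (eqs y) signr_addb.
  have := congr1 (fun m => m%:R : rat) eJ; rewrite /= !natrM natrX.
  move: (fix_num _ _ _)%:R (n ^ _ - 1)%:R => J S eJS.
  have ss (b : bool) : ((-1) ^+ b * (-1) ^+ b = 1 :> rat).
    by rewrite -signr_addb addbb.
  (* Clearing n^q reduces the equation to [eJ]; the sign of [delta] occurs twice and squares to
     1. *)
  apply: (mulIf (Nq0 q)); rewrite !mulrA mulfVK //.
  move: (ss (delta < 0)); move: eJS.
  move: ((-1) ^+ (delta < 0)%R) ((-1) ^+ (y < 0)%R) => s1 s2 eJS s11.
  transitivity ((s1 * s1) * s2 * (J * (n.-1%:R * (absz delta)%:R))).
    by ring.
  by rewrite eJS s11; ring.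
- by rewrite aval_fix_word.
- move=> g /fixE; rewrite aval_fix_word /=.
  case ek: (aval g).2 => [[|k]|k] // + _.
  (* With z = l / n^r, clearing n^r gives q | n^r |y| (n^k - 1) for the height k of g, and r can
     then be replaced by q. *)
  have /asboolP[l [r ->]] := aval_Zinv n2 g.
  rewrite -natX N1 => /(congr1 (fun z => z * N ^+ r)).
  rewrite -!mulrA mulVf // mulr1 => e.
  have /(congr1 absz) : delta * (n.-1%:Z * l) =
      y * ((n ^ k.+1 - 1)%N%:Z * (n ^ r)%N%:Z).
    by apply: (@intr_inj rat); rewrite !rmorphM /= -!pmulrn natrX.
  rewrite !abszM !absz_nat => {}e; rewrite lez_nat ltnS; apply: k_min.
  rewrite -mulnA; apply: (dvdn_expn_stable (r := r)) => //.
  by rewrite mulnC -mulnA -e mulnA [(`|delta| * _)%N]mulnC dvdn_mulr.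
Qed.

End Generator.

(** * The code of a generator as a computable function *)

Section GeneratorCode.

Definition repeat_digit d m := \sum_(i < m) d * 4 ^ i.

Definition fix_word_code n q y d :=
  repeat_digit 4 q + 4 ^ q * (repeat_digit d (fix_num n q y) +
    4 ^ fix_num n q y * repeat_digit 2 (q + fix_expt n q y)).

Lemma fix_word_codeE n q y b :
  fix_word_code n q y (digit (false, b)) = code (fix_word n q y b).
Proof.
by rewrite /fix_word !code_cat !code_nseq !size_nseq.
Qed.

(** Integers are kept as differences of naturals: n^m x = xp - xn, n^m y = yp - yn and n^m (1 - x) =
    d - xp. Absolute values are sums of two truncated differences. If x = 0 the code of the image of
    t is returned; otherwise the last argument is the digit of a or a^-1, as the signs of 1 - x and
    y agree or not. *)
Definition generator_code n cu cv :=
  let m := cu + cv in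
  let xp := part 1 m n cu cu in let xn := part 3 m n cu cu in
  let yp := part 1 m n cv cv in let yn := part 3 m n cv cv in
  let d := n ^ m + xn in
  (xp == xn) * cv + (1 - (xp == xn)) *
  fix_word_code n (n.-1 * ((d - xp) + (xp - d))) ((yp - yn) + (yn - yp))
    (1 + 2 * (1 - ((d.+1 <= xp : nat) == (yp.+1 <= yn : nat)))).

Local Notation "s `_ i" := (nth 0 s i) : nat_scope.

Lemma computable_rest k f :
  computable k f -> computable k (fun s => rest (f s)).
Proof.
move=> fC; apply: computable_div (computable_const k 4).
exact: computable_pred.
Qed.

Lemma computable_nth_digit k f g : computable k f -> computable k g ->
  computable k (fun s => nth_digit (f s) (g s)).
Proof.
have itC : computable 2 (fun s => iter s`_0 rest s`_1).
  apply: eq_computable (computable_iterate (k := 2) (F := fun s => rest s`_1)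
    (computable_nth (isT : 0 < 2)) (computable_nth (isT : 1 < 2)) _).
    by move=> s /=; elim: s`_0 => //= i ->.
  exact/computable_rest/computable_nth.
apply: (computable_op2 (h := nth_digit)); apply: (computable_sub itC _).
exact: computable_mul (computable_const 2 4) (computable_rest itC).
Qed.

Lemma computable_occ k d f g : computable k f -> computable k g ->
  computable k (fun s => occ d (f s) (g s)).
Proof.
apply: (computable_op2 (h := occ d)).
apply: (computable_sum (F := fun s => nth_digit s`_0 s`_2 == d : nat)).
  exact: computable_nth.
apply: computable_eq (computable_const 3 d).
by apply: computable_nth_digit; exact: computable_nth.
Qed.

Lemma computable_part k d f g h :
  computable k f -> computable k g -> computable k h ->
  computable k (fun s => part d (f s) (g s) (h s) (h s)).
Proof.
apply: (computable_op3 (h := fun m n c => part d m n c c)).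
apply: (computable_sum (F := fun s => (nth_digit s`_0 s`_3 == d) *
  s`_2 ^ (s`_1 + occ 2 s`_0 s`_3 - occ 4 s`_0 s`_3))).
  exact: computable_nth.
have i0 := computable_nth (isT : 0 < 4).
have i1 := computable_nth (isT : 1 < 4).
have i2 := computable_nth (isT : 2 < 4).
have i3 := computable_nth (isT : 3 < 4).
apply: computable_mul.
  by apply: computable_eq (computable_const 4 d); exact: computable_nth_digit.
apply: (computable_exp i2 _); apply: computable_sub; last exact: computable_occ.
by apply: (computable_add i1 _); exact: computable_occ.
Qed.

Lemma computable_fix_expt k f g h :
  computable k f -> computable k g -> computable k h ->
  computable k (fun s => fix_expt (f s) (g s) (h s)).
Proof.
apply: (computable_op3 (h := fix_expt)); apply: computable_succ.
(* Each sum prepends its index: n, q, y sit at positions 1, 2, 3 here and at 2, 3, 4 in the inner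
   sum. *)
apply: (computable_sum (F := fun s => \sum_(j < (s`_0).+1)
  (s`_2 %| s`_1 ^ s`_2 * s`_3 * (s`_1 ^ j.+1 - 1)) == 0 : nat)).
  exact: computable_nth.
apply: computable_eq (computable_const 4 0).
apply: (computable_sum (F := fun s =>
  s`_3 %| s`_2 ^ s`_3 * s`_4 * (s`_2 ^ (s`_0).+1 - 1) : nat)).
  exact/computable_succ/computable_nth.
have i0 := computable_nth (isT : 0 < 5).
have i2 := computable_nth (isT : 2 < 5).
have i3 := computable_nth (isT : 3 < 5).
have i4 := computable_nth (isT : 4 < 5).
apply: (computable_dvdn i3 _); apply: computable_mul.
  by apply: (computable_mul _ i4); exact: computable_exp.
apply: computable_sub (computable_const 5 1); apply: (computable_exp i2 _).
exact: computable_succ.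
Qed.

Lemma computable_fix_num k f g h :
  computable k f -> computable k g -> computable k h ->
  computable k (fun s => fix_num (f s) (g s) (h s)).
Proof.
move=> fC gC hC; apply: (computable_div _ gC); apply: computable_mul.
  by apply: (computable_mul _ hC); exact: computable_exp.
apply: computable_sub (computable_const k 1); apply: (computable_exp fC _).
exact: computable_fix_expt.
Qed.

Lemma computable_repeat_digit k f g : computable k f -> computable k g ->
  computable k (fun s => repeat_digit (f s) (g s)).
Proof.
apply: (computable_op2 (h := repeat_digit)).
apply: (computable_sum (F := fun s => s`_1 * 4 ^ s`_0)).
  exact: computable_nth.
apply: computable_mul (computable_nth (isT : 1 < 3)) _.
exact: computable_exp (computable_const 3 4) (computable_nth (isT : 0 < 3)).
Qed.

Lemma computable_fix_word_code k f g h d :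
  computable k f -> computable k g -> computable k h -> computable k d ->
  computable k (fun s => fix_word_code (f s) (g s) (h s) (d s)).
Proof.
move=> fC gC hC dC; have cC := computable_const k.
have jC := computable_fix_num fC gC hC.
have rC c e : computable k e -> computable k (fun s => repeat_digit c (e s)).
  by move=> eC; apply: computable_repeat_digit.
apply: computable_add (rC 4 _ gC) _.
apply: computable_mul; first exact: computable_exp.
apply: computable_add; first exact: computable_repeat_digit.
apply: computable_mul; first exact: computable_exp.
by apply: rC; apply: (computable_add gC _); exact: computable_fix_expt.
Qed.

Lemma computable_generator_code :
  computable 3 (fun s => generator_code s`_0 s`_1 s`_2).
Proof.
have nC := computable_nth (isT : 0 < 3).
have uC := computable_nth (isT : 1 < 3).
have vC := computable_nth (isT : 2 < 3); have cC := computable_const 3.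
have mC := computable_add uC vC.
have xpC := computable_part 1 mC nC uC; have xnC := computable_part 3 mC nC uC.
have ypC := computable_part 1 mC nC vC; have ynC := computable_part 3 mC nC vC.
have dC := computable_add (computable_exp nC mC) xnC.
have bC := computable_eq xpC xnC.
apply: computable_add; first exact: computable_mul.
apply: computable_mul; first exact: computable_sub.
apply: computable_fix_word_code => //.
- apply: computable_mul; first exact: computable_pred.
  by apply: computable_add; exact: computable_sub.
- by apply: computable_add; exact: computable_sub.
- apply: computable_add => //; apply: computable_mul => //.
  apply: computable_sub => //.
  apply: computable_eq; apply: computable_leq => //;
  exact: computable_succ.
Qed.

End GeneratorCode.

(** * The cases x = 0, x = 1 and the remaining x *)

Section FixedSubgroup.
Import Order.TTheory GRing.Theory Num.Theory.
Local Open Scope ring_scope.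
Variable n : nat.
Hypothesis n2 : (2 <= n)%N.
Local Notation N := (n%:R : rat).
Variable phi : {multiplicative BS n -> BS n}.
Local Notation pa := (phi (bs_a n)).
Local Notation pt := (phi (bs_t n)).

Lemma generates_degenerate : (aval pa).1 = 0 -> (aval pt).2 = 1 ->
  generates pt (fixg phi).
Proof.
move=> x0 t1; apply: (generates_min n2); rewrite ?t1 //.
  move=> g /(fixg_degenerate n2 _ x0) {2}-> ->.
  by [].
by apply/(fixg_degenerate n2 _ x0); rewrite t1.
Qed.

(** A fixed g of height k is the k-th power of the image of t, of height l; hence k = l k, and k =
    0. *)
Lemma fix_trivial : (aval pa).1 = 0 -> (aval pt).2 != 1 ->
  forall g, g \in fixg phi <-> g = 1%g.
Proof.
move=> x0 t1 g; split=> [/(fixg_degenerate n2 _ x0) gE | ->]; last first.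
  by rewrite inE mulmorph1.
have /eqP := congr1 (fun g => (aval g).2) gE; rewrite (aval_zexpg n2).
rewrite -subr_eq0 -{1}[(aval g).2]mul1r -mulrBl mulf_eq0 subr_eq0 eq_sym.
by rewrite (negPf t1) => /eqP g0; rewrite gE g0.
Qed.

Lemma fix_unipotent g : (aval pa).1 = 1 -> (aval pt).2 = 1 ->
  ~ (phi =1 id) -> g \in fixg phi <-> (aval g).2 = 0.
Proof.
move=> x1 t1 phi1; apply: iff_trans (fixgP n2 g t1) _.
rewrite x1 subrr !mul0r; split=> [/esym/eqP|->]; last first.
  by rewrite expr0z subrr mulr0.
rewrite mulf_eq0 => /orP[/eqP y0|].
  case: phi1; apply: (endo_id n2 x1).
  by rewrite -t1 -y0; case: (aval pt).
rewrite subr_eq0 -[X in _ == X](expr0z N) => /eqP.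
apply: ieexprIz; first by rewrite ltr0n ltnW.
by rewrite gt_eqF // (base_gt1 n2).
Qed.

(** The n-th root of a translation divides it by n within Z[1/n]. With [isomorphic_int_ker] this
    rules out x = 1 when the fixed subgroup is infinite cyclic. *)
Lemma expt0_divisible (g : BS n) : (aval g).2 = 0 ->
  exists2 h : BS n, (aval h).2 = 0 & (h ^+ n)%g = g.
Proof.
move=> g0; have [h hE] := aval_surj n2 0 (Zinv_div (aval_Zinv n2 g)).
have h0 : (aval h).2 = 0 by rewrite hE.
exists h => //; apply: (aval_inj n2).
rewrite [LHS]surjective_pairing (aval_expg n2) h0 mul0rn.
rewrite (aval_expg0 n2 _ h0) hE /= mulVKf ?(base_neq0 n2) //.
by rewrite -g0 -surjective_pairing.
Qed.

Lemma generator_code_degenerate u v : (aval pa).1 = 0 -> pa = of_word n u ->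
  generator_code n (code u) (code v) = code v.
Proof.
move=> x0 eu; pose m := (code u + code v)%N.
have um : (size u <= m)%N := leq_trans (size_leq_code u) (leq_addr _ _).
have := aword_part n2 um (size_leq_code u).
rewrite -(aval_word n2) -eu x0 mul0r /generator_code -/m => /esym/eqP.
rewrite subr_eq0 eqr_nat => ->.
by rewrite mul1n subnn mul0n addn0.
Qed.

(** Multiplying the equation of [fixgP] by n^m makes its coefficients integers, and x != 1 keeps the
    leading one nonzero, so [generates_fix_word] applies. *)
Lemma fix_word_generates u v : (aval pa).1 != 0 -> (aval pa).1 != 1 ->
  pa = of_word n u -> pt = of_word n v ->
  exists w, [/\ generator_code n (code u) (code v) = code w,
    generates (of_word n w) (fixg phi) & (aval (of_word n w)).2 != 0].
Proof.
move=> x0 x1 eu ev.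
have [/eqP|t1] := endo_cases n2 phi; first by rewrite (negPf x0).
(* This m bounds the lengths of both words, so both are decoded exactly at the same scale. *)
pose m := (code u + code v)%N.
have Nm0 : N ^+ m != 0 by rewrite expf_neq0 ?base_neq0.
have um : (size u <= m)%N := leq_trans (size_leq_code u) (leq_addr _ _).
have vm : (size v <= m)%N := leq_trans (size_leq_code v) (leq_addl _ _).
have xE := aword_part n2 um (size_leq_code u).
have yE := aword_part n2 vm (size_leq_code v).
rewrite -(aval_word n2) -eu in xE; rewrite -(aval_word n2) -ev in yE.
rewrite /generator_code -/m.
move: (part 1 m n _ (code u)) (part 3 m n _ (code u)) xE => xp xn xE.
move: (part 1 m n _ (code v)) (part 3 m n _ (code v)) yE => yp yn yE.
set x := (aval pa).1 in x0 x1 xE; set y := (aval pt).1 in yE.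
have xpn : (xp == xn) = false.
  apply: contraNF x0 => /eqP e; rewrite e subrr in xE.
  by move/eqP: xE; rewrite mulf_eq0 (negPf Nm0) orbF.
pose delta : int := (n ^ m + xn)%N%:Z - xp%:Z; pose z : int := yp%:Z - yn%:Z.
have deltaE : delta%:~R = (1 - x) * N ^+ m :> rat.
  by rewrite mulrBl mul1r xE /delta rmorphB /= -!pmulrn natrD natrX; ring.
have zE : z%:~R = y * N ^+ m :> rat by rewrite yE /z rmorphB /= -!pmulrn.
have delta0 : delta != 0.
  rewrite -(intr_eq0 rat) deltaE mulf_eq0 (negPf Nm0) orbF subr_eq0 eq_sym.
  exact: x1.
have fixE g : g \in fixg phi <->
    delta%:~R * (N - 1) * (aval g).1 = z%:~R * (N ^ (aval g).2 - 1).
  apply: iff_trans (fixgP n2 g t1) _; rewrite deltaE zE -/x -/y.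
  move: (N ^+ m) Nm0 (N ^ (aval g).2 - 1) (N - 1) (aval g).1 => M M0 S K c.
  have -> : (1 - x) * M * K * c = M * ((1 - x) * K * c) by ring.
  have -> : y * M * S = M * (y * S) by ring.
  by split=> [->|/(mulfI M0)].
exists (fix_word n (n.-1 * `|delta|) `|z| ((delta < 0) (+) (z < 0))).
split; last by rewrite (aval_fix_word n2).
  rewrite xpn mul0n add0n subn0 mul1n -fix_word_codeE.
  congr fix_word_code; rewrite /digit /delta /z /=; try lia.
exact: (generates_fix_word n2 delta0 fixE).
Qed.

End FixedSubgroup.

Theorem theorem1p3 :
  (forall (n : nat) (phi : {multiplicative BS n -> BS n}),
     (2 <= n)%N -> ~ (phi =1 id) ->
     [\/ isomorphic_groups (fix_group phi) (Algebra.to_multiplicative int),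
         isomorphic_groups (fix_group phi) (Algebra.to_multiplicative (Zinv_type n))
       | forall g : BS n, g \in fixg phi <-> g = 1%g]) /\
  (exists p : murec 3,
     forall (n : nat) (phi : {multiplicative BS n -> BS n}) (u v : word),
       (2 <= n)%N -> ~ (phi =1 id) ->
       phi (bs_a n) = of_word n u -> phi (bs_t n) = of_word n v ->
       isomorphic_groups (fix_group phi) (Algebra.to_multiplicative int) ->
       exists w : word,
         computes p [tuple n; code u; code v] (code w) /\
         generates (of_word n w) (fixg phi)).
Proof.
split=> [n phi n2 phi_id|].
  have [x0|x0] := eqVneq (aval (phi (bs_a n))).1 0%R.
    have [t1|t1] := eqVneq (aval (phi (bs_t n))).2 1%R.
      apply: Or31; apply: (isomorphic_int n2 _ (generates_degenerate n2 x0 t1)).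
      by rewrite t1.
    by apply: Or33; exact: fix_trivial.
  have [x1|x1] := eqVneq (aval (phi (bs_a n))).1 1%R.
    apply: Or32; apply: (isomorphic_Zinv n2) => g.
    apply: fix_unipotent => //.
    by case: (endo_cases n2 phi) x0 => // ->; rewrite eqxx.
  have [w [_ gen w0]] := fix_word_generates n2 x0 x1
    (esym (of_word_repr _)) (esym (of_word_repr _)).
  by apply: Or31; exact: (isomorphic_int n2 w0 gen).
have [p pP] := computable_generator_code.
(* The isomorphism with Z yields a fixed g that is nontrivial, against the trivial case, and not an
   n-th power of a fixed element, against the case x = 1. *)
exists p => n phi u v n2 phi_id eu ev /(isomorphic_int_ker n2)[g [gfix g1 gdiv]].
have [x0|x0] := eqVneq (aval (phi (bs_a n))).1 0%R.
  have [t1|t1] := eqVneq (aval (phi (bs_t n))).2 1%R.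
    exists v; split; last by rewrite -ev; exact: generates_degenerate.
    move: (pP [tuple n; code u; code v]) => /=.
    by rewrite (generator_code_degenerate n2 v x0 eu).
  by case: g1; apply/(fix_trivial n2 x0 t1).
have [x1|x1] := eqVneq (aval (phi (bs_a n))).1 1%R.
  have t1 : (aval (phi (bs_t n))).2 = 1%R.
    by case: (endo_cases n2 phi) x0 => // ->; rewrite eqxx.
  have fixE h := fix_unipotent n2 h x1 t1 phi_id.
  case: gdiv; have [h h0 hn] := expt0_divisible n2 ((fixE g).1 gfix).
  by exists h => //; exact/fixE.
have [w [wE gen _]] := fix_word_generates n2 x0 x1 eu ev.
by exists w; split; rewrite -?wE //; exact: pP [tuple n; code u; code v].
Qed.
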